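(* Let $n\geq 1$ and let $2\leq d_1\leq\cdots\leq d_n$ be a sequence of integers. Then there are a finite field $K=\mathbb{F}_q$ and a degenerate torus $X^*\subset K^n$ such that, for every integer $d\geq 1$, the code $C_{X^*}(d)$ has length $d_1\cdots d_n$, dimension $$ \dim_K C_{X^*}(d)=\binom{n+d}{d}-\sum_{1\leq i\leq n}\binom{n+d-d_i}{d-d_i}+\sum_{i<j}\binom{n+d-(d_i+d_j)}{d-(d_i+d_j)}-\sum_{i<j<k}\binom{n+d-(d_i+d_j+d_k)}{d-(d_i+d_j+d_k)}+\cdots+(-1)^n\binom{n+d-(d_1+\cdots+d_n)}{d-(d_1+\cdots+d_n)}, $$ minimum distance $\delta_{X^*}(d)=1$ if $d\geq\sum_{i=1}^n(d_i-1)$, and minimum distance $$ \delta_{X^*}(d)=(d_{k+1}-\ell)\,d_{k+2}\cdots d_n\quad\text{if } d\leq\sum_{i=1}^n(d_i-1)-1, $$ where $k\geq 0$ and $\ell$ are the unique integers such that $d=\sum_{i=1}^k(d_i-1)+\ell$ and $1\leq\ell\leq d_{k+1}-1$.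
   Context: For a finite field $K=\mathbb{F}_q$ with $K^*=K\setminus\{0\}$ and a sequence $v=(v_1,\ldots,v_n)$ of positive integers, the set $X^*=\{(x_1^{v_1},\ldots,x_n^{v_n}) : x_i\in K^*\text{ for all }i\}\subset K^n$ is called a degenerate torus (of type $v$). Let $S=K[t_1,\ldots,t_n]$, let $S_{\leq d}$ be the $K$-vector space of polynomials of $S$ of total degree at most $d$, and let $P_1,\ldots,P_m$ be the points of $X^*$. The evaluation map is $\mathrm{ev}_d\colon S_{\leq d}\to K^{|X^*|}$, $f\mapsto (f(P_1),\ldots,f(P_m))$, and $C_{X^*}(d)$ is its image. The length of $C_{X^*}(d)$ is $|X^*|$, its dimension is $\dim_K C_{X^*}(d)$, and its minimum distance is $\delta_{X^*}(d)=\min\{\|\mathrm{ev}_d(f)\| : f\in S_{\leq d},\ \mathrm{ev}_d(f)\neq 0\}$, where $\|\cdot\|$ is the number of non-zero entries. Conventions: a binomial coefficient $\binom{n+e}{e}$ with $e<0$ is $0$; the product $d_{k+2}\cdots d_n$ is $1$ if $k=n-1$. *)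

(* Defs.v *)
From HB Require Import structures.
From mathcomp Require Import all_boot all_order all_algebra.
From mathcomp Require Import mpoly.

Set Implicit Arguments.
Unset Strict Implicit.
Unset Printing Implicit Defensive.

Import GRing.Theory.
Local Open Scope ring_scope.

Section BoundedPolynomials.
Variables (n : nat) (K : fieldType) (d : nat).

(* [msize] is the total degree plus one, and [msize 0 = 0]. *)
Definition mdegle : {pred {mpoly K[n]}} := fun p => (msize p <= d.+1)%N.

Lemma mdegle_submod_closed : submod_closed mdegle.
Proof.
split=> [|c p q]; rewrite /mdegle !unfold_in /mdegle; first by rewrite msize0.
move=> hp hq; apply: leq_trans (msizeD_le _ _) _.
by rewrite geq_max hq andbT; apply: leq_trans (msizeZ_le _ _) hp.
Qed.

HB.instance Definition _ :=
  GRing.isSubmodClosed.Build K {mpoly K[n]} mdegle mdegle_submod_closed.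

Record polyle := Polyle { polyle_val :> {mpoly K[n]}; _ : polyle_val \in mdegle }.

HB.instance Definition _ := [isSub for polyle_val].
HB.instance Definition _ := [Choice of polyle by <:].
HB.instance Definition _ := [SubChoice_isSubLmodule of polyle by <:].

Lemma polyle_vecaxiom : Vector.axiom #|{: 'X_{1..n < d.+1}}| polyle.
Proof.
pose N := #|{: 'X_{1..n < d.+1}}|.
pose M (i : 'I_N) : 'X_{1..n} := val (enum_val i).
pose f (p : polyle) : 'rV[K]_N := \row_i (val p)@_(M i).
pose g (r : 'rV[K]_N) : {mpoly K[n]} := \sum_i r 0 i *: 'X_[M i].
have gP r : g r \in mdegle.
  rewrite /g; apply: rpred_sum => i _; apply: rpredZ.
  by rewrite unfold_in /mdegle msizeX ltnS -ltnS bmdeg.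
have fl : linear f.
  by move=> c p q; apply/rowP=> i; rewrite !mxE /= mcoeffD mcoeffZ.
exists f => //; exists (fun r => Polyle (gP r)).
- move=> p; apply/val_inj; rewrite /= /g.
  rewrite [RHS](@mpolywE _ _ d.+1); last by case: p.
  rewrite (reindex (@enum_val _ {: 'X_{1..n < d.+1}})) /=; last first.
    by apply: onW_bij; exact: enum_val_bij.
  by apply: eq_bigr => i _; rewrite mxE.
- move=> r; apply/rowP=> j; rewrite mxE /= /g raddf_sum (bigD1 j) //=.
  rewrite mcoeffZ mcoeffX eqxx mulr1 big1 ?addr0 // => k ne_kj.
  rewrite mcoeffZ mcoeffX /M (inj_eq val_inj) (inj_eq enum_val_inj).
  by rewrite (negbTE ne_kj) mulr0.
Qed.

HB.instance Definition _ := Lmodule_hasFinDim.Build K polyle polyle_vecaxiom.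

End BoundedPolynomials.

Section EvaluationCode.
Variables (n : nat) (K : finFieldType).

Definition degenerate_torus (v : 'I_n -> nat) : {set {ffun 'I_n -> K}} :=
  [set [ffun i => x i ^+ v i] | x : {ffun 'I_n -> K} & [forall i, x i != 0]].

Variables (X : {set {ffun 'I_n -> K}}) (d : nat).

Definition ev (f : polyle n K d) : 'rV[K]_#|X| :=
  \row_(j < #|X|) (val f).@[(enum_val j : {ffun 'I_n -> K})].

Lemma ev_is_linear : linear ev.
Proof. by move=> c p q; apply/rowP=> i; rewrite !mxE mevalD mevalZ. Qed.

HB.instance Definition _ :=
  GRing.isLinear.Build K (polyle n K d) 'rV[K]_#|X| _ ev ev_is_linear.

Definition code : {vspace 'rV[K]_#|X|} := limg (linfun ev).

Lemma mem_code (c : 'rV[K]_#|X|) :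
  c \in code <-> exists f : polyle n K d, c = ev f.
Proof.
split=> [/memv_imgP[f _ ->]|[f ->]]; first by exists f; rewrite lfunE.
by rewrite -[ev f]lfunE memv_img ?memvf.
Qed.

End EvaluationCode.

(* The length of a code is the dimension of its ambient space. *)
Definition code_length (K : fieldType) (m : nat) (C : {vspace 'rV[K]_m}) : nat := m.

Definition hweight (K : fieldType) (m : nat) (c : 'rV[K]_m) : nat :=
  #|[set j | c 0 j != 0]|.

Definition is_min (P : nat -> Prop) (a : nat) : Prop :=
  P a /\ forall b, P b -> (a <= b)%N.

Definition is_min_dist (n : nat) (K : finFieldType)
    (X : {set {ffun 'I_n -> K}}) (d a : nat) : Prop :=
  is_min (fun w => exists f : polyle n K d, ev X f != 0 /\ hweight (ev X f) = w) a.

(* Binomial coefficient (n + e) over e, with value 0 for e < 0. *)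
Definition binz (n : nat) (e : int) : nat :=
  if e is Posz k then 'C(n + k, k) else 0.

(* The index [k : 'I_n] counts from 0, so [ds k] is d_{k+1}, the sum runs over
   d_1, ..., d_k, and k <= n - 1. *)
Definition is_decomp (n : nat) (ds : 'I_n -> nat) (d : nat) (k : 'I_n) (l : nat) :
    Prop :=
  d = (\sum_(i < n | i < k) (ds i - 1) + l)%N /\ (1 <= l <= ds k - 1)%N.

(* Main.v *)
(** Choose K with d_1 ... d_n dividing q - 1 and v_i = (q - 1) / d_i: the
    degenerate torus is then the product X of the groups of d_i-th roots of
    unity.  On X the monomial t^m only depends on the exponents modulo the
    d_i, and reducing them does not raise the degree; since |X| is invertible
    in K, orthogonality of characters shows that the reduced monomials
    (m_i < d_i) are independent on X.  So the dimension is the number of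
    reduced monomials of degree at most d, counted by inclusion-exclusion.

    Minimum distance: let f be reduced with leading monomial t^a for a
    degree-first order.  If g is a nonzero combination of monomials t^b with
    b_i < d_i - a_i, then f g has a reduced leading monomial, so it does not
    vanish on X; hence g is determined by its values on the non-zeros of f,
    and f has at least prod (d_i - a_i) of them.  Products of linear factors
    attain this number for every a, and prod (d_i - a_i) under the constraint
    sum a_i <= d is minimised by filling the a_i greedily from the left. *)

Require Import Defs.
From mathcomp Require Import all_boot all_order all_algebra.
From mathcomp Require Import all_field cyclic.
From mathcomp Require Import mpoly zify.

Set Implicit Arguments.
Unset Strict Implicit.
Unset Printing Implicit Defensive.

Import GRing.Theory.
Local Open Scope ring_scope.

(** * The combinatorial minimum *)

(* The value of prod (d_i - a_i) when a total of [d] is distributed greedily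
   over the a_i <= d_i - 1, starting from the first one. *)
Fixpoint greedy_weight (n : nat) : ('I_n -> nat) -> nat -> nat :=
  if n is m.+1 then fun ds d =>
    if (d < ds ord0)%N then ((ds ord0 - d) * \prod_(i < m) ds (lift ord0 i))%N
    else greedy_weight (fun i => ds (lift ord0 i)) (d - (ds ord0 - 1))
  else fun=> fun=> 1%N.

(* The exchange step: leaving a first factor [e] instead of 1 frees [e - 1]
   more units for the remaining variables, and this never pays. *)
Lemma greedy_weight_trade n (ds : 'I_n -> nat) (d e : nat) :
    (forall i, 1 < ds i)%N -> {homo ds : i j / (i <= j)%N} ->
    (0 < e)%N -> (forall i, e <= ds i)%N ->
  (greedy_weight ds d <= e * greedy_weight ds (d + (e - 1)))%N.
Proof.
elim: n ds d => [|n IHn] ds d /=; first by move=> _ _ ?; rewrite muln1.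
move=> ds_gt1 ds_mono e_gt0 le_e_ds; have [gt1c le_ec] := (ds_gt1 ord0, le_e_ds ord0).
have gt1' i : (1 < ds (lift ord0 i))%N by [].
have mono' : {homo (fun i => ds (lift ord0 i)) : i j / (i <= j)%N}.
  by move=> i j le_ij; apply: ds_mono; rewrite /= leq_bump2.
case: ifP => [lt_dc|/negbT]; last first.
  rewrite -leqNgt => le_cd; rewrite ifN; last by lia.
  by rewrite -addnBAC; [apply: IHn | lia].
case: ifP => [lt_dec|/negbT].
  rewrite mulnA leq_mul2r; apply/orP; right.
  have -> : (ds ord0 - d = (ds ord0 - (d + (e - 1))) + (e - 1))%N by lia.
  have: (0 < ds ord0 - (d + (e - 1)))%N by lia.
  by move: (ds ord0 - _)%N => t; nia.
rewrite -leqNgt => le_cde; set P := (\prod_(i < n) _)%N.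
case: n ds gt1' mono' @P {IHn} => [|n] ds gt1' mono' P
  in ds_gt1 ds_mono le_e_ds gt1c le_ec lt_dc le_cde *.
  by rewrite /P big_ord0 /=; lia.
rewrite /= /P big_ord_recl; set Q := (\prod_(i < n) _)%N.
have le_cc : (ds ord0 <= ds (lift ord0 ord0))%N by exact: ds_mono.
rewrite ifT; last by lia.
(* The units that the first variable cannot hold number d + e - c < e. Apart from [Q], the two sides
   differ by (e - (c - d)) (c' - e) >= 0, where c and c' are the first two values of [ds]. *)
by rewrite !mulnA leq_mul2r; apply/orP; right; nia.
Qed.

(** Induction on [n]: once [a ord0] is fixed, the tail is at best greedy with budget [d - a ord0].
    If the greedy choice exhausts the first variable, the exchange step with [e = ds ord0 - a ord0]
    concludes; otherwise only the first two factors have to be compared. *)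
Lemma greedy_weight_le n (ds a : 'I_n -> nat) (d : nat) :
    (forall i, 1 < ds i)%N -> {homo ds : i j / (i <= j)%N} ->
    (forall i, a i < ds i)%N -> (\sum_i a i <= d)%N ->
  (greedy_weight ds d <= \prod_i (ds i - a i))%N.
Proof.
elim: n ds a d => [|n IHn] ds a d /=; first by move=> *; rewrite big_ord0.
move=> ds_gt1 ds_mono lt_a_ds; rewrite !big_ord_recl /= => le_sd.
have gt1' i : (1 < ds (lift ord0 i))%N by [].
have mono' : {homo (fun i => ds (lift ord0 i)) : i j / (i <= j)%N}.
  by move=> i j le_ij; apply: ds_mono; rewrite /= leq_bump2.
have lt_ac := lt_a_ds ord0.
have {}IHn : (greedy_weight (fun i => ds (lift ord0 i)) (d - a ord0)
   <= \prod_i (ds (lift ord0 i) - a (lift ord0 i)))%N.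
  apply: IHn => //.
  by rewrite leq_subRL 1?(leq_trans (leq_addr _ _) le_sd).
apply: leq_trans (leq_mul (leqnn _) IHn).
case: ifP => [lt_dc|/negbT]; last first.
  rewrite -leqNgt => le_cd.
  have -> : (d - a ord0 = d - (ds ord0 - 1) + ((ds ord0 - a ord0) - 1))%N by lia.
  apply: greedy_weight_trade => // [|i]; first by lia.
  by apply: leq_trans (leq_subr _ _) _; apply: ds_mono.
case: n ds a gt1' mono' IHn => [|n] ds a gt1' mono' IHn
  in ds_gt1 ds_mono lt_a_ds lt_ac le_sd lt_dc *.
  by rewrite big_ord0 /=; lia.
rewrite /= big_ord_recl; set Q := (\prod_(i < n) _)%N.
have le_cc : (ds ord0 <= ds (lift ord0 ord0))%N by exact: ds_mono.
rewrite ifT; last by lia.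
(* Apart from [Q], the two sides differ by (d - a) (c' - c + a) >= 0, where a is the first exponent
   and c <= c' are the first two values of [ds]. *)
by rewrite !mulnA leq_mul2r; apply/orP; right; nia.
Qed.

Lemma greedy_weightE n (ds : 'I_n -> nat) d (k : 'I_n) l :
    (forall i, 1 < ds i)%N -> is_decomp ds d k l ->
  greedy_weight ds d = ((ds k - l) * \prod_(i < n | (k < i)%N) ds i)%N.
Proof.
elim: n ds d k => [|n IHn] ds d k ds_gt1; first by case: k.
case: (unliftP ord0 k) => [j|] -> [/= -> /andP[l_gt0 le_l]].
  rewrite big_mkcond big_ord_recl /= -big_mkcond /=.
  rewrite [in RHS]big_mkcond big_ord_recl /= -big_mkcond /= mul1n.
  have gt1c := ds_gt1 ord0.
  rewrite ifN; last by lia.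
  apply: IHn => //; split; last by rewrite l_gt0.
  by rewrite -addnA [X in (X - _)%N]addnC addnK.
have gt1c := ds_gt1 ord0.
rewrite big_pred0 // add0n ifT; last by lia.
by congr (_ * _)%N; rewrite [in RHS]big_mkcond big_ord_recl /= mul1n.
Qed.

(** If k' < k, then l' fits into the term of index k', so the second decomposition is at most the
    sum over i < k; the first one exceeds that sum because l > 0. *)
Lemma is_decomp_le n (ds : 'I_n -> nat) d k l k' l' :
  is_decomp ds d k l -> is_decomp ds d k' l' -> (k <= k')%N.
Proof.
move=> [-> /andP[l_gt0 le_l]] [eq_d /andP[l'_gt0 le_l']]; rewrite leqNgt.
apply/negP => lt_kk'; move: eq_d; apply/eqP; rewrite neq_ltn orbC.
apply/orP; left; apply: (@leq_ltn_trans (\sum_(i < n | (i < k)%N) (ds i - 1))).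
  rewrite [X in (_ <= X)%N](bigD1 k') //= addnC leq_add //.
  rewrite big_mkcond [X in (_ <= X)%N]big_mkcond leq_sum // => i _.
  by do 2?case: ifP => //; rewrite -val_eqE /=; lia.
by rewrite -[X in (X < _)%N]addn0 ltn_add2l.
Qed.

Lemma is_decomp_uniq n (ds : 'I_n -> nat) d k l k' l' :
  is_decomp ds d k l -> is_decomp ds d k' l' -> (k, l) = (k', l').
Proof.
move=> D D'; have eq_k : k = k'.
  by apply/val_inj/eqP; rewrite eqn_leq (is_decomp_le D D') (is_decomp_le D' D).
by case: D D' => [-> _] [+ _]; rewrite eq_k => /addnI ->.
Qed.

Lemma is_decomp_exists n (ds : 'I_n -> nat) d :
  (0 < d)%N -> (d <= \sum_(i < n) (ds i - 1))%N ->
  exists k l, is_decomp ds d k l.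
Proof.
elim: n ds d => [|n IHn] ds d; first by rewrite big_ord0; lia.
rewrite big_ord_recl => d_gt0 le_d.
have [le_dc|lt_cd] := leqP d (ds ord0 - 1)%N.
  by exists ord0, d; split; rewrite ?d_gt0 ?big_pred0.
have [||k [l [def_d lP]]] := IHn (fun i => ds (lift ord0 i)) (d - (ds ord0 - 1))%N;
  try lia.
exists (lift ord0 k), l; split => //.
by rewrite big_mkcond big_ord_recl /= -big_mkcond /= -addnA -def_d; lia.
Qed.

(** * Roots of unity in finite fields *)

(** A prime p > N is coprime to N, so by Euler's theorem the field with p ^ totient N elements
    works. *)
Lemma exists_finField_dvdn_card N :
  (0 < N)%N -> exists K : finFieldType, (N %| #|K|.-1)%N.
Proof.
move=> N_gt0; have [p ltNp p_pr] := prime_above N.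
have tN_gt0 : (0 < totient N)%N by rewrite totient_gt0.
have [K _ cardK] := pPrimePowerField p_pr tN_gt0.
exists K; rewrite cardK -subn1 -eqn_mod_dvd ?expn_gt0 ?prime_gt0 //.
apply/eqP/Euler_exp_totient; rewrite prime_coprime //.
by apply: contraL ltNp => /(dvdn_leq N_gt0); rewrite -leqNgt.
Qed.

Section RootsOfUnity.
Variables (K : finFieldType).
Implicit Types (d m : nat) (x y w : K).

Definition unity_roots d : {set K} := [set y | y ^+ d == 1].

Lemma card_finField_pred_gt0 : (0 < #|K|.-1)%N.
Proof. by rewrite -subn1 subn_gt0; exact: finNzRing_gt1. Qed.

Lemma expf_card_pred x : x != 0 -> x ^+ #|K|.-1 = 1.
Proof.
move=> x_neq0; apply: (mulfI x_neq0); rewrite mulr1 -exprS.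
by rewrite (ltn_predK (finNzRing_gt1 K)) expf_card.
Qed.

Lemma exists_prim_root_card : exists w, (#|K|.-1).-primitive_root w.
Proof.
have /hasP[w _ prim_w] : has (#|K|.-1).-primitive_root (enum [set~ (0 : K)]).
  apply: has_prim_root; rewrite ?enum_uniq ?card_finField_pred_gt0 //.
    apply/allP => x; rewrite mem_enum !inE => x_neq0.
    by rewrite unity_rootE expf_card_pred.
  by rewrite -cardE cardsC1.
by exists w.
Qed.

Lemma exists_prim_root d :
  (d %| #|K|.-1)%N -> exists w, d.-primitive_root w.
Proof.
move=> dvd_d; have [w prim_w] := exists_prim_root_card.
by exists (w ^+ (#|K|.-1 %/ d)); apply: dvdn_prim_root.
Qed.

Lemma sum_unity_roots d (V : nmodType) (F : K -> V) w : d.-primitive_root w ->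
  \sum_(y in unity_roots d) F y = \sum_(i < d) F (w ^+ i).
Proof.
move=> prim_w; have inj_w : injective (fun i : 'I_d => w ^+ i).
  move=> i j /eqP; rewrite (eq_prim_root_expr prim_w) !modn_small //.
  by move/eqP/val_inj.
rewrite -(big_imset _ (in2W inj_w)) /=; apply: eq_bigl => y; rewrite inE.
apply/eqP/imsetP => [yd1|[i _ ->]]; last first.
  by rewrite exprAC (prim_expr_order prim_w) expr1n.
by have [i ->] := prim_rootP prim_w yd1; exists i.
Qed.

Lemma card_unity_roots d : (d %| #|K|.-1)%N -> #|unity_roots d| = d.
Proof.
move=> /exists_prim_root[w prim_w].
by rewrite -sum1_card (sum_unity_roots _ prim_w) sum1_card card_ord.
Qed.

Lemma unity_roots_natf_neq0 d : (d %| #|K|.-1)%N -> d%:R != 0 :> K.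
Proof. by move=> /exists_prim_root[w]; apply: prim_root_natf_neq0. Qed.

(** If [d] does not divide [m], the sum is geometric with ratio [w ^+ m] different from 1, and the
    [d]-th power of this ratio is 1. *)
Lemma sum_unity_roots_exp d m : (d %| #|K|.-1)%N ->
  \sum_(y in unity_roots d) y ^+ m = if (d %| m)%N then d%:R else 0.
Proof.
move=> dvd_d; have [w prim_w] := exists_prim_root dvd_d.
case: ifP => [/dvdnP[k ->]|/negbT Ndvd].
  rewrite -[in RHS](card_unity_roots dvd_d) -sumr_const.
  apply: eq_bigr => y; rewrite inE => /eqP yd1.
  by rewrite mulnC exprM yd1 expr1n.
rewrite (sum_unity_roots _ prim_w).
under eq_bigr do rewrite exprAC.
have wm_neq1 : w ^+ m - 1 != 0 by rewrite subr_eq0 -(prim_order_dvd prim_w).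
apply: (mulfI wm_neq1); rewrite mulr0 -subrX1 exprAC.
by rewrite (prim_expr_order prim_w) expr1n subrr.
Qed.

(** The multiplicative group is cyclic: if a power [w ^+ i] of a generator is a [d]-th root of
    unity, then (q - 1) / d divides [i]. *)
Lemma exp_image_unity_roots d : (d %| #|K|.-1)%N ->
  [set x ^+ (#|K|.-1 %/ d) | x : K & x != 0] = unity_roots d.
Proof.
move=> dvd_d; have [w prim_w] := exists_prim_root_card.
have d_gt0 : (0 < d)%N := dvdn_gt0 card_finField_pred_gt0 dvd_d.
apply/setP => y; rewrite inE; apply/imsetP/eqP => [[x + ->]|yd1].
  by rewrite inE => x_neq0; rewrite -exprM divnK ?expf_card_pred.
have [|i def_y] := prim_rootP prim_w (x := y).
  by rewrite -(divnK dvd_d) mulnC exprM yd1 expr1n.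
move/eqP: yd1; rewrite def_y -exprM -(prim_order_dvd prim_w).
rewrite -{1}(divnK dvd_d) dvdn_pmul2r // => /dvdnP[k ->].
exists (w ^+ k); last by rewrite exprM.
by rewrite inE expf_neq0 // (prim_root_eq0 prim_w) -lt0n card_finField_pred_gt0.
Qed.

End RootsOfUnity.

(** * Evaluation on a product of groups of roots of unity *)

Lemma card_set_prod (I J : finType) (A : I -> {set J}) :
  #|[set f : {ffun I -> J} | [forall i, f i \in A i]]| = (\prod_i #|A i|)%N.
Proof.
under eq_bigr do rewrite -sum1_card.
rewrite bigA_distr_big_dep -sum1_card; apply: eq_big => [f|f _].
  by rewrite inE; apply/forallP/familyP.
by rewrite big1_eq.
Qed.

Section LinearCombination.
Variables (n : nat) (R : nzRingType) (J : finType) (mon : J -> 'X_{1..n}).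
Variable (c : J -> R).
Let g : {mpoly R[n]} := \sum_j c j *: 'X_[mon j].

Lemma mcoeff_sum_mpolyX j : injective mon -> g@_(mon j) = c j.
Proof.
move=> mon_inj.
rewrite raddf_sum (bigD1 j) //= mcoeffZ mcoeffX eqxx mulr1 big1 ?addr0 // => k kj.
by rewrite mcoeffZ mcoeffX (inj_eq mon_inj) (negbTE kj) mulr0.
Qed.

Lemma mlead_sum_mpolyX : g != 0 -> exists j, mlead g = mon j.
Proof.
move=> /mlead_supp/msupp_sum_le/flatten_mapP[j _].
by move=> /msuppZ_le; rewrite msuppX inE => /eqP ->; exists j.
Qed.

End LinearCombination.

Section UnityTorus.
Variables (n : nat) (K : finFieldType) (ds : 'I_n -> nat).
Hypothesis dvd_ds : forall i, (ds i %| #|K|.-1)%N.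

Definition unity_torus : {set {ffun 'I_n -> K}} :=
  [set x : {ffun 'I_n -> K} | [forall i, x i \in unity_roots K (ds i)]].

Definition reduced (m : 'X_{1..n}) := [forall i, (m i < ds i)%N].

Lemma unity_order_gt0 i : (0 < ds i)%N.
Proof. exact: dvdn_gt0 (card_finField_pred_gt0 K) (dvd_ds i). Qed.

Lemma unity_torusP (x : {ffun 'I_n -> K}) :
  reflect (forall i, x i ^+ ds i = 1) (x \in unity_torus).
Proof.
by rewrite inE; apply: (iffP forallP) => [x1 i|x1 i]; have := x1 i;
  rewrite inE => /eqP.
Qed.

Lemma degenerate_torusE :
  degenerate_torus K (fun i => #|K|.-1 %/ ds i)%N = unity_torus.
Proof.
apply/setP=> x; apply/imsetP/idP => [[y + ->]|].
  rewrite !inE => /forallP y_neq0; apply/forallP => i.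
  rewrite ffunE -(exp_image_unity_roots (dvd_ds i)).
  by apply/imsetP; exists (y i); rewrite ?inE.
rewrite inE => /forallP /= xP.
have /fin_all_exists[y yP] i : exists y, y != 0 /\ x i = y ^+ (#|K|.-1 %/ ds i).
  have := xP i; rewrite -(exp_image_unity_roots (dvd_ds i)).
  by case/imsetP => y; rewrite inE => y_neq0 ->; exists y.
exists [ffun i => y i]; last by apply/ffunP => i; rewrite !ffunE; case: (yP i).
by rewrite inE; apply/forallP => i; rewrite ffunE; case: (yP i).
Qed.

Lemma card_unity_torus : #|unity_torus| = (\prod_i ds i)%N.
Proof.
rewrite card_set_prod; apply: eq_bigr => i _; exact: card_unity_roots.
Qed.

(* Orthogonality of the characters x |-> x^m of the group [unity_torus]. *)
Lemma sum_unity_torus_monomial (m : 'I_n -> nat) :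
  \sum_(x : {ffun 'I_n -> K} | x \in unity_torus) \prod_i x i ^+ m i =
    if [forall i, (ds i %| m i)%N] then (\prod_i ds i)%:R else 0 :> K.
Proof.
transitivity (\prod_i \sum_(y in unity_roots K (ds i)) y ^+ m i).
  rewrite bigA_distr_big_dep; apply: eq_bigl => x.
  by rewrite inE; apply/forallP/familyP.
under eq_bigr do rewrite sum_unity_roots_exp //.
case: forallP => [dvd_m|/forallP/forallPn[i Ndvd_m]].
  by rewrite natr_prod; apply: eq_bigr => i _; rewrite dvd_m.
by rewrite (bigD1 i) //= (negbTE Ndvd_m) mul0r.
Qed.

(* Pair [p] with the character x |-> x^(-b); the exponents [c] below represent -b. *)
Lemma vanishing_coef_sum (p : {mpoly K[n]}) (b : 'X_{1..n}) :
    (forall x : {ffun 'I_n -> K}, x \in unity_torus -> p.@[x] = 0) ->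
  \sum_(m <- msupp p | [forall i, m i == b i %[mod ds i]]) p@_m = 0.
Proof.
move=> p0; pose c i := (ds i - b i %% ds i)%N.
have prod_neq0 : (\prod_i ds i)%:R != 0 :> K.
  by rewrite natr_prod prodf_seq_neq0; apply/allP => i _; rewrite unity_roots_natf_neq0.
apply: (mulIf prod_neq0); rewrite mul0r mulr_suml.
transitivity
  (\sum_(x : {ffun 'I_n -> K} | x \in unity_torus) p.@[x] * \prod_i x i ^+ c i); last first.
  by apply: big1 => x xX; rewrite p0 ?mul0r.
have expand (x : {ffun 'I_n -> K}) : p.@[x] * \prod_i x i ^+ c i
    = \sum_(m <- msupp p) p@_m * \prod_i x i ^+ (m i + c i).
  rewrite mevalE mulr_suml; apply: eq_bigr => m _.
  by rewrite -mulrA -big_split; congr (_ * _); apply: eq_bigr => i _; rewrite exprD.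
under [RHS]eq_bigr do rewrite expand.
rewrite exchange_big /= big_mkcond; apply: eq_bigr => m _; rewrite -mulr_sumr.
rewrite sum_unity_torus_monomial.
have -> : [forall i, (ds i %| m i + c i)%N] = [forall i, m i == b i %[mod ds i]].
  apply: eq_forallb => i; rewrite /c.
  rewrite -(eqn_modDr (ds i - b i %% ds i)) /dvdn; congr (_ == _).
  rewrite -modnDml subnKC ?modnn // ltnW // ltn_mod unity_order_gt0 //.
by case: ifP => // _; rewrite mulr0.
Qed.

Lemma reduced_modn (m b : 'X_{1..n}) : reduced b ->
  (forall i, m i = b i %[mod ds i]) -> forall i, (b i <= m i)%N.
Proof.
move=> /forallP b_red eq_mb i; have := eq_mb i; rewrite (modn_small (b_red i)) => <-.
exact: leq_mod.
Qed.

(* The order on monomials compares degrees first, and a monomial congruent to a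
   reduced one without being equal to it has larger degree: the coefficient sum
   over the class of [mlead p] is the leading coefficient alone. *)
Lemma mlead_reduced_nonvanishing (p : {mpoly K[n]}) :
    p != 0 -> reduced (mlead p) ->
  exists2 x : {ffun 'I_n -> K}, x \in unity_torus & p.@[x] != 0.
Proof.
move=> p_neq0 red_p.
have [/exists_inP//|/exists_inPn p0] :=
  boolP [exists x : {ffun 'I_n -> K} in unity_torus, p.@[x] != 0].
have {}p0 (x : {ffun 'I_n -> K}) : x \in unity_torus -> p.@[x] = 0.
  by move=> /p0; rewrite negbK => /eqP.
have := vanishing_coef_sum (mlead p) p0.
rewrite big_mkcond (bigD1_seq (mlead p)) ?mlead_supp ?msupp_uniq //=.
rewrite ifT; last exact/forallP.
rewrite big_seq_cond big1 => [|m /andP[m_supp m_neq]].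
  by rewrite addr0 => /eqP; rewrite mleadc_eq0 (negbTE p_neq0).
case: ifP => // /forallP eq_m; case/eqP: m_neq.
have le_m : forall i, (mlead p i <= m i)%N.
  by apply: reduced_modn => // i; apply/eqP.
have def_m : m = (mlead p + (m - mlead p))%MM.
  by apply/mnmP => i; rewrite mnmDE mnmBE subnKC.
have := lemc_mdeg (msupp_le_mlead m_supp).
rewrite {1}def_m mdegD -[X in (_ <= X)%N]addn0 leq_add2l leqn0 mdeg_eq0.
by move=> /eqP eq0; rewrite def_m eq0 addm0.
Qed.

Lemma footprint_bound (p : {mpoly K[n]}) : p != 0 -> reduced (mlead p) ->
  (\prod_i (ds i - mlead p i) <=
    #|[set x : {ffun 'I_n -> K} in unity_torus | p.@[x] != 0%R]|)%N.
Proof.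
move=> p_neq0 red_p; set Y := [set x in _ | _].
(* [N] only serves to provide a finite type containing all exponents of the box. *)
pose N := (\max_i ds i).
pose A i : {set 'I_N.+1} := [set j : 'I_N.+1 | (j < ds i - mlead p i)%N].
pose B := [set b : {ffun 'I_n -> 'I_N.+1} | [forall i, b i \in A i]].
have cardA i : #|A i| = (ds i - mlead p i)%N.
  have le_dN : (ds i - mlead p i <= N.+1)%N.
    by apply: leq_trans (leq_subr _ _) (leqW _); apply: leq_bigmax.
  have inj_w : injective (widen_ord le_dN) by move=> j k /(congr1 val)/= /val_inj.
  rewrite -[RHS]card_ord -(card_image inj_w).
  apply: eq_card => j; rewrite inE; apply/idP/imageP => [lt_j|[k _ ->]] //=.
  by exists (Ordinal lt_j) => //; apply: val_inj.
have -> : (\prod_i (ds i - mlead p i) = #|B|)%N.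
  by rewrite card_set_prod; apply: eq_bigr => i _; rewrite cardA.
(* [M] evaluates the monomials with exponents in the box [B] at the non-zeros of [p]. *)
pose M := \matrix_(j < #|B|, k < #|Y|)
  \prod_i (enum_val k : {ffun 'I_n -> K}) i ^+ (enum_val j : {ffun 'I_n -> 'I_N.+1}) i.
suffices /eqP <- : row_free M by exact: rank_leq_col.
apply/inj_row_free => v vM0; apply/rowP => j0; rewrite mxE.
apply/eqP/negPn/negP => v_j0.
pose mon (j : 'I_#|B|) : 'X_{1..n} :=
  [multinom (enum_val j : {ffun 'I_n -> 'I_N.+1}) i : nat | i < n].
have mon_inj : injective mon.
  move=> j k /mnmP eq_jk; apply/enum_val_inj/ffunP => i; apply: val_inj.
  by have := eq_jk i; rewrite !mnmE.
pose g : {mpoly K[n]} := \sum_j v 0 j *: 'X_[mon j].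
have g_neq0 : g != 0.
  by apply: contraNneq v_j0 => g0;
    rewrite -(mcoeff_sum_mpolyX _ j0 mon_inj) -/g g0 mcoeff0.
have [j lead_g] := mlead_sum_mpolyX g_neq0.
have [||x xX] := @mlead_reduced_nonvanishing (p * g); first by rewrite mulf_neq0.
  apply/forallP => i; rewrite mleadM // mnmDE lead_g mnmE.
  by have := enum_valP j; rewrite inE => /forallP/(_ i); rewrite inE ltn_subRL.
(* The point [x] is a non-zero of [p], hence indexes a column of [M], and the entry of [v *m M]
   there is the value of [g] at [x]; so that value is 0, a contradiction. *)
rewrite mevalM mulf_eq0 negb_or => /andP[px_neq0 /eqP[]].
have xY : x \in Y by rewrite inE xX.
transitivity ((v *m M) 0 (enum_rank_in xY x)); last by rewrite vM0 mxE.
rewrite mxE raddf_sum; apply: eq_bigr => k _.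
rewrite /= mevalZ mevalX mxE enum_rankK_in //; congr (_ * _).
by apply: eq_bigr => i _; rewrite mnmE.
Qed.

Definition reduce_mnm (m : 'X_{1..n}) : 'X_{1..n} := [multinom m i %% ds i | i < n]%N.

Definition reduce_mpoly (p : {mpoly K[n]}) : {mpoly K[n]} :=
  \sum_(m <- msupp p) p@_m *: 'X_[reduce_mnm m].

Lemma mdeg_reduce_mnm m : (mdeg (reduce_mnm m) <= mdeg m)%N.
Proof. by rewrite !mdegE leq_sum // => i _; rewrite mnmE leq_mod. Qed.

Lemma reduced_reduce_mnm m : reduced (reduce_mnm m).
Proof. by apply/forallP => i; rewrite mnmE ltn_mod unity_order_gt0. Qed.

Lemma meval_reduce_mpoly p (x : {ffun 'I_n -> K}) : x \in unity_torus ->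
  (reduce_mpoly p).@[x] = p.@[x].
Proof.
move=> /unity_torusP xX; rewrite [RHS]mevalE raddf_sum; apply: eq_bigr => m _.
rewrite /= mevalZ mevalX; congr (_ * _); apply: eq_bigr => i _.
by rewrite mnmE expr_mod.
Qed.

(** Only an inclusion holds: several monomials may reduce to the same one and their coefficients may
    cancel. *)
Lemma msupp_reduce_mpoly p m : m \in msupp (reduce_mpoly p) ->
  exists2 m', m' \in msupp p & m = reduce_mnm m'.
Proof.
move=> /msupp_sum_le/flatten_mapP[m']; rewrite mem_filter /= => m'_supp.
by move=> /msuppZ_le; rewrite msuppX inE => /eqP ->; exists m'.
Qed.

End UnityTorus.

(** * The evaluation code *)

Section BoundedDegree.
Variables (n : nat) (K : fieldType).

Lemma mdegleM d1 d2 (p q : {mpoly K[n]}) :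
  p \in mdegle d1 -> q \in mdegle d2 -> p * q \in mdegle (d1 + d2).
Proof.
rewrite !unfold_in /mdegle => le_p le_q.
have [->|p_neq0] := eqVneq p 0; first by rewrite mul0r msize0.
have [->|q_neq0] := eqVneq q 0; first by rewrite mulr0 msize0.
by rewrite msizeM // -subn1 leq_subLR add1n -addnS -addSn leq_add.
Qed.

Lemma mdegle_prod (I : Type) (r : seq I) (P : pred I) (F : I -> {mpoly K[n]})
    (e : I -> nat) : (forall i, P i -> F i \in mdegle (e i)) ->
  \prod_(i <- r | P i) F i \in mdegle (\sum_(i <- r | P i) e i).
Proof.
move=> Fe; elim/big_rec2: _ => [|i d q Pi]; first by rewrite unfold_in /mdegle msize1.
by apply: mdegleM; apply: Fe.
Qed.

Lemma mdegle_XsubC i c : 'X_i - c%:MP \in mdegle (n := n) (K := K) 1.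
Proof.
by apply: rpredB; rewrite unfold_in /mdegle ?msizeX ?mdeg1 // msizeC; case: eqP.
Qed.

Lemma mdegle_le d1 d2 (p : {mpoly K[n]}) :
  (d1 <= d2)%N -> p \in mdegle d1 -> p \in mdegle d2.
Proof. by rewrite !unfold_in /mdegle => le_d /leq_trans; apply. Qed.

End BoundedDegree.

Section UnityTorusCode.
Variables (n : nat) (K : finFieldType) (ds : 'I_n -> nat).
Hypothesis dvd_ds : forall i, (ds i %| #|K|.-1)%N.
Variable d : nat.
Let X := unity_torus K ds.

Lemma hweight_ev (f : polyle n K d) :
  hweight (ev X f) = #|[set x : {ffun 'I_n -> K} in X | (val f).@[x] != 0]|.
Proof.
rewrite /hweight -(card_imset _ (@enum_val_inj _ (mem X))).
apply: eq_card => x; rewrite inE; apply/imsetP/andP => [[j + ->]|[xX fx]].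
  by rewrite inE mxE enum_valP.
exists (enum_rank_in xX x); last by rewrite enum_rankK_in.
by rewrite inE mxE enum_rankK_in.
Qed.

Lemma ev_eqP (f g : polyle n K d) :
  (forall x : {ffun 'I_n -> K}, x \in X -> (val f).@[x] = (val g).@[x]) ->
  ev X f = ev X g.
Proof. by move=> eq_fg; apply/rowP => j; rewrite !mxE eq_fg ?enum_valP. Qed.

Lemma reduce_mpoly_mdegle (f : polyle n K d) :
  reduce_mpoly ds (val f) \in mdegle (n := n) (K := K) d.
Proof.
rewrite /reduce_mpoly big_seq; apply: rpred_sum => m m_supp; apply: rpredZ.
rewrite unfold_in /mdegle msizeX ltnS; apply: leq_trans (mdeg_reduce_mnm _ _) _.
by rewrite -ltnS; apply: leq_trans (msize_mdeg_lt m_supp) _; case: f {m_supp}.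
Qed.

(** The reduction of [f] gives the same codeword without raising the degree bound; [a] is the
    exponent of its leading monomial, to which the footprint bound applies. *)
Lemma hweight_ev_ge (f : polyle n K d) : ev X f != 0 ->
  exists a : 'I_n -> nat, [/\ forall i, (a i < ds i)%N, (\sum_i a i <= d)%N
    & (\prod_i (ds i - a i) <= hweight (ev X f))%N].
Proof.
pose g := Polyle (reduce_mpoly_mdegle f).
have <- : ev X g = ev X f by apply: ev_eqP => x; apply: meval_reduce_mpoly.
move=> evg_neq0; have g_neq0 : val g != 0.
  apply: contraNneq evg_neq0 => g0; apply/eqP/rowP => j.
  by rewrite !mxE g0 meval0.
have red_g : reduced ds (mlead (val g)).
  have [m _ ->] := msupp_reduce_mpoly (mlead_supp g_neq0).
  exact: reduced_reduce_mnm.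
exists (mlead (val g)); split; first exact/forallP.
  have : (msize (val g) <= d.+1)%N by case: (g).
  by rewrite -mlead_deg // ltnS mdegE.
by rewrite hweight_ev; apply: footprint_bound.
Qed.

(** Choose [a i] roots of unity in each coordinate and multiply the linear factors vanishing there:
    the non-zeros form the product of the complements. *)
Lemma exists_hweight_ev (a : 'I_n -> nat) :
    (forall i, a i < ds i)%N -> (\sum_i a i <= d)%N ->
  exists f : polyle n K d, hweight (ev X f) = (\prod_i (ds i - a i))%N.
Proof.
move=> lt_ad le_ad.
have /fin_all_exists[T TP] i : exists T : {set K},
    T \subset unity_roots K (ds i) /\ #|T| = a i.
  have : (a i <= #|unity_roots K (ds i)|)%N by rewrite card_unity_roots // ltnW.
  case/card_geqP => s [s_uniq <- s_sub]; exists [set y in s]; split.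
    by apply/subsetP => y; rewrite inE; apply: s_sub.
  by rewrite cardsE (card_uniqP s_uniq).
pose f : {mpoly K[n]} := \prod_i \prod_(y in T i) ('X_i - y%:MP).
have f_deg : f \in mdegle d.
  apply: mdegle_le le_ad _; apply: mdegle_prod => i _.
  have [_ <-] := TP i; rewrite -sum1_card; apply: mdegle_prod => y _.
  exact: mdegle_XsubC.
exists (Polyle f_deg); rewrite hweight_ev.
have -> : (\prod_i (ds i - a i) = \prod_i #|unity_roots K (ds i) :\: T i|)%N.
  apply: eq_bigr => i _; have [subT cardT] := TP i.
  by rewrite cardsD (setIidPr subT) cardT card_unity_roots.
rewrite -card_set_prod; apply: eq_card => x; rewrite !inE /=.
rewrite /f rmorph_prod prodf_seq_neq0 /=.
apply/andP/forallP => [[/forallP xX /allP fx] i|xP].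
  rewrite inE xX andbT; have := fx i; rewrite mem_index_enum => /(_ isT).
  apply: contra => xT; rewrite rmorph_prod (bigD1 (x i)) //=.
  by rewrite mevalB mevalXU mevalC subrr mul0r.
split; first by apply/forallP => i; have := xP i; rewrite inE => /andP[].
apply/allP => i _; rewrite rmorph_prod prodf_seq_neq0; apply/allP => y _ /=.
apply/implyP => yT; rewrite mevalB mevalXU mevalC subr_eq0.
by apply: contraTneq yT => <-; have := xP i; rewrite inE => /andP[].
Qed.

Lemma hweight_eq0 m (c : 'rV[K]_m) : (hweight c == 0%N) = (c == 0).
Proof.
rewrite cards_eq0; apply/eqP/eqP => [c0|->].
  by apply/rowP => j; have /setP/(_ j) := c0; rewrite !inE mxE => /negbFE/eqP.
by apply/setP => j; rewrite !inE mxE eqxx.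
Qed.

Lemma is_min_distI (a : 'I_n -> nat) :
    (forall i, a i < ds i)%N -> (\sum_i a i <= d)%N ->
    (forall b : 'I_n -> nat, (forall i, b i < ds i)%N -> (\sum_i b i <= d)%N ->
      (\prod_i (ds i - a i) <= \prod_i (ds i - b i))%N) ->
  is_min_dist X d (\prod_i (ds i - a i)).
Proof.
move=> lt_ad le_ad min_a; split=> [|_ [f [/hweight_ev_ge[b [lt_bd le_bd le_b]] <-]]].
  have [f hf] := exists_hweight_ev lt_ad le_ad; exists f; split=> //.
  (* The weight is a product of positive factors, so the codeword is non-zero. *)
  rewrite -hweight_eq0 hf -lt0n prodn_gt0 // => i.
  by rewrite subn_gt0.
by apply: leq_trans le_b; apply: min_a.
Qed.

(** The evaluations of the reduced monomials of degree at most [d] form a basis of the code. *)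
Lemma dim_code :
  \dim (code X d) = #|[set m : 'X_{1..n < d.+1} | reduced ds m]|.
Proof.
set S := [set m | _].
have monP (m : 'X_{1..n < d.+1}) : 'X_[bmnm m] \in mdegle (n := n) (K := K) d.
  by rewrite unfold_in /mdegle msizeX bmdeg.
pose e := [tuple ev X (Polyle (monP (enum_val j))) | j < #|S|].
have e_nth (j : 'I_#|S|) : e`_j = ev X (Polyle (monP (enum_val j))).
  by rewrite -tnth_nth tnth_mktuple.
suffices [eq_code free_e] : <<e>>%VS = code X d /\ free e.
  by rewrite -eq_code; move: free_e; rewrite /free size_tuple => /eqP.
split.
  apply/eqP; rewrite eqEsubv; apply/andP; split.
    apply/span_subvP => c /mapP[j _ ->]; apply/mem_code.
    by exists (Polyle (monP (enum_val j))).
  apply/subvP => c /mem_code[f ->].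
  pose g := Polyle (reduce_mpoly_mdegle f).
  have <- : ev X g = ev X f by apply: ev_eqP => x; apply: meval_reduce_mpoly.
  suffices -> : ev X g = \sum_(j < #|S|) (val g)@_(bmnm (enum_val j)) *: e`_j.
    by apply: rpred_sum => j _; rewrite memvZ ?memv_span ?mem_nth ?size_tuple.
  apply/rowP => x; rewrite mxE summxE {1}[val g](@mpolywE _ _ d.+1); last by case: (g).
  (* Only reduced monomials occur in [g], so the terms outside [S] vanish. *)
  rewrite raddf_sum (bigID (fun m => m \in S)) /= [X in _ + X]big1 ?addr0.
    rewrite big_enum_val; apply: eq_bigr => j _.
    by rewrite e_nth /= mevalZ !mxE.
  move=> m mNS; rewrite mevalZ memN_msupp_eq0 ?mul0r //.
  apply: contra mNS => /msupp_reduce_mpoly[m' _ eq_m].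
  by rewrite inE eq_m (reduced_reduce_mnm dvd_ds).
apply/freeP => k sum0 j.
pose mon (j : 'I_#|S|) : 'X_{1..n} := bmnm (enum_val j).
have mon_inj : injective mon by move=> j1 j2 /val_inj/enum_val_inj.
pose g : {mpoly K[n]} := \sum_j k j *: 'X_[mon j].
have [g0|g_neq0] := eqVneq g 0.
  by rewrite -(mcoeff_sum_mpolyX k j mon_inj) -/g g0 mcoeff0.
have [j' lead_g] := mlead_sum_mpolyX g_neq0.
(* A non-trivial relation would give a polynomial with reduced leading monomial that vanishes on the
   whole torus. *)
have [|x xX /eqP[]] := @mlead_reduced_nonvanishing _ _ _ dvd_ds g g_neq0.
  by rewrite lead_g; have := enum_valP j'; rewrite inE.
transitivity ((\sum_(i < #|S|) k i *: e`_i) 0 (enum_rank_in xX x)).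
  rewrite summxE raddf_sum; apply: eq_bigr => i _.
  by rewrite e_nth /= mevalZ !mxE enum_rankK_in.
by rewrite sum0 mxE.
Qed.

End UnityTorusCode.

(** * Counting reduced monomials *)

(** Exponent vectors of degree at most [d] are the [n]-tuples over ['I_d.+1] with sum at most [d],
    whose number is a known binomial. *)
Lemma card_bmultinom n d : #|{: 'X_{1..n < d.+1}}| = 'C(n + d, d).
Proof.
have -> : 'C(n + d, d) = 'C(n + d, n) by rewrite -bin_sub ?leq_addl // addnK.
rewrite -card_partial_ord_partitions.
pose f (m : 'X_{1..n < d.+1}) : n.-tuple 'I_d.+1 := [tuple inord (bmnm m i) | i < n].
have le_md (m : 'X_{1..n < d.+1}) i : (bmnm m i < d.+1)%N.
  by apply: leq_ltn_trans (bmdeg m); rewrite mdegE (bigD1 i) //= leq_addr.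
have f_inj : injective f.
  move=> m1 m2 eq_f; apply/val_inj/mnmP => i.
  by have := congr1 (fun t => val (tnth t i)) eq_f; rewrite !tnth_mktuple /= !inordK.
rewrite -(card_image f_inj); apply: eq_card => t; rewrite inE.
apply/imageP/idP => [[m _ ->]|le_td].
  rewrite big_tuple; under eq_bigr do rewrite tnth_mktuple inordK //.
  by rewrite -mdegE -ltnS bmdeg.
have mdeg_t : (mdeg [multinom tnth t i : nat | i < n] < d.+1)%N.
  rewrite ltnS mdegE; under eq_bigr do rewrite mnmE.
  by rewrite big_tuple in le_td.
exists (BMultinom mdeg_t) => //; apply: eq_from_tnth => i; apply: val_inj.
by rewrite tnth_mktuple /= mnmE inord_val.
Qed.

Lemma card_bmultinom_ge n d (b : 'X_{1..n}) :
  #|[set m : 'X_{1..n < d.+1} | (b <= bmnm m)%MM]| =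
    binz n (d%:Z - (mdeg b)%:Z).
Proof.
have [le_bd|lt_db] := leqP (mdeg b) d; last first.
  (* A negative difference is where [binz] is 0 by convention; no multiple of t^b has degree at most
     [d] then. *)
  have -> : d%:Z - (mdeg b)%:Z = Negz (mdeg b - d).-1 by lia.
  apply: eq_card0 => m; rewrite inE; apply/negbTE/mnm_lepP => le_bm.
  have := bmdeg m; rewrite ltnS leqNgt => /negP[]; apply: leq_trans lt_db _.
  by rewrite !mdegE leq_sum.
rewrite subzn //= -card_bmultinom.
have degD (m : 'X_{1..n < (d - mdeg b).+1}) : (mdeg (bmnm m + b) < d.+1)%N.
  by have := bmdeg m; rewrite mdegD; lia.
(* Multiplication by t^b is a bijection from the monomials of degree at most [d - mdeg b] onto the
   set to be counted. *)
pose f m := BMultinom (degD m).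
have f_inj : injective f by move=> m1 m2 /(congr1 (@bmnm _ _))/addIm/val_inj.
rewrite -(card_image f_inj); apply: eq_card => m; rewrite inE.
apply/mnm_lepP/imageP => [le_bm|[m' _ ->] i]; last by rewrite /= mnmDE leq_addl.
have eq_m : (bmnm m - b + b)%MM = m by apply/mnmP => i; rewrite mnmDE mnmBE subnK.
have degB : (mdeg (bmnm m - b) < (d - mdeg b).+1)%N.
  by have := bmdeg m; rewrite -{1}eq_m mdegD; lia.
by exists (BMultinom degB) => //; apply: val_inj; rewrite /= eq_m.
Qed.

(** Inclusion-exclusion: the indicator of reduced monomials is the product of the factors 1 -
    [d_i <= m_i]. It is expanded over the subsets [I], which are then grouped by cardinality. *)
Lemma card_reduced_bmultinom n (ds : 'I_n -> nat) d :
  #|[set m : 'X_{1..n < d.+1} | reduced ds m]|%:Z =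
    \sum_(r < n.+1) (-1) ^+ r *
      \sum_(I : {set 'I_n} | #|I| == r)
        (binz n (d%:Z - (\sum_(i in I) ds i)%N%:Z))%:Z.
Proof.
pose ge (m : 'X_{1..n < d.+1}) i : int := (ds i <= bmnm m i)%N%:R.
have cardZ (A : {set 'X_{1..n < d.+1}}) : #|A|%:Z = \sum_m (m \in A)%:R.
  rewrite -natz -sum1_card natr_sum big_mkcond; apply: eq_bigr => m _.
  by case: (m \in A).
transitivity (\sum_(m : 'X_{1..n < d.+1}) \prod_i (- ge m i + 1)).
  rewrite cardZ; apply: eq_bigr => m _.
  rewrite inE; case: (boolP (reduced ds m)) => [/forallP red_m|/forallPn[i]].
    by rewrite big1 // => i _; rewrite /ge leqNgt red_m oppr0 add0r.
  by rewrite -leqNgt => le_m; rewrite (bigD1 i) //= /ge le_m addNr mul0r.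
under eq_bigr do rewrite bigA_distr.
rewrite exchange_big /=.
rewrite (partition_big (fun I : {set 'I_n} => inord #|I| : 'I_n.+1) xpredT) //=.
apply: eq_bigr => r _; rewrite mulr_sumr.
have cardE (I : {set 'I_n}) : (inord #|I| == r) = (#|I| == r).
  by rewrite -val_eqE /= inordK // ltnS -[n in (_ <= n)%N]card_ord max_card.
apply: eq_big => [//|I]; rewrite cardE => /eqP <-.
(* The conditions d_i <= m_i for all i in [I] say together that t^b divides t^m. *)
pose b := [multinom if i \in I then ds i else 0%N | i < n].
have -> : (\sum_(i in I) ds i)%N = mdeg b.
  by rewrite mdegE big_mkcond; apply: eq_bigr => i _; rewrite mnmE.
rewrite -card_bmultinom_ge cardZ mulr_sumr.
apply: eq_bigr => m _; rewrite -big_mkcond /= prodrN; congr (_ * _).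
rewrite inE; case: mnm_lepP => [le_bm|/mnm_lepP/forallPn[i]].
  by rewrite big1 // => i iI; have := le_bm i; rewrite mnmE iI /ge => ->.
rewrite mnmE; case: ifP => // iI; rewrite -ltnNge => lt_m.
by rewrite (bigD1 i) //= /ge leqNgt lt_m mul0r.
Qed.

(** * Choice of the field and the torus, and derivation of the code parameters *)

Theorem theorem4p2 (n : nat) (ds : 'I_n -> nat)
    (hn : (1 <= n)%N)
    (hds2 : forall i : 'I_n, (2 <= ds i)%N)
    (hds_mono : forall i j : 'I_n, (i <= j)%N -> (ds i <= ds j)%N) :
  exists (K : finFieldType) (v : 'I_n -> nat),
    (forall i : 'I_n, (0 < v i)%N) /\
    let X := degenerate_torus K v in
    forall d : nat, (1 <= d)%N ->
      [/\ code_length (code X d) = (\prod_(i < n) ds i)%N,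
          (\dim (code X d))%:Z =
            \sum_(r < n.+1) (-1) ^+ r *
              \sum_(I : {set 'I_n} | #|I| == r)
                (binz n (d%:Z - (\sum_(i in I) ds i)%N%:Z))%:Z,
          (\sum_(i < n) (ds i - 1) <= d)%N -> is_min_dist X d 1
        & (d <= \sum_(i < n) (ds i - 1) - 1)%N ->
            (exists! kl : 'I_n * nat, is_decomp ds d kl.1 kl.2) /\
            forall (k : 'I_n) (l : nat), is_decomp ds d k l ->
              is_min_dist X d ((ds k - l) * \prod_(i < n | (k < i)%N) ds i)%N].
Proof.
have ds_gt0 i : (0 < ds i)%N by exact: ltnW.
have prod_gt0 : (0 < \prod_i ds i)%N by exact: prodn_gt0.
(* Taking the product of all d_i makes each of them divide q - 1. *)
have [K dvd_K] := exists_finField_dvdn_card prod_gt0.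
have dvd_ds i : (ds i %| #|K|.-1)%N.
  by apply: dvdn_trans dvd_K; rewrite (bigD1 i) //= dvdn_mulr.
exists K, (fun i => #|K|.-1 %/ ds i)%N; split=> [i|].
  by rewrite divn_gt0 // dvdn_leq // card_finField_pred_gt0.
rewrite (degenerate_torusE dvd_ds) => X d d_gt0; split.
- exact: card_unity_torus.
- by rewrite (dim_code dvd_ds) card_reduced_bmultinom.
(* For large [d] the exponents a_i = d_i - 1 are affordable, and the product of the d_i - a_i is
   then 1, its least possible value. *)
- move=> le_d; have prod1 : (\prod_i (ds i - (ds i - 1)) = 1)%N.
    by apply: big1 => i _; rewrite subKn.
  rewrite -prod1; apply: is_min_distI => // [i|b lt_b _].
    by rewrite subn1 prednK.
  by rewrite prod1 prodn_gt0 // => i; rewrite subn_gt0.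
move=> le_d; split.
  have [|k [l D]] := is_decomp_exists (ds := ds) d_gt0.
    exact: leq_trans le_d (leq_subr _ _).
  by exists (k, l); split=> // -[k' l']; apply: is_decomp_uniq.
move=> k l D; have [def_d /andP[l_gt0 le_l]] := D.
(* The greedy distribution: the variables before [k] are filled, [k] receives the remainder [l], and
   the later ones receive nothing. *)
pose a (i : 'I_n) := if (i < k)%N then (ds i - 1)%N else if i == k then l else 0%N.
have lt_a i : (a i < ds i)%N.
  rewrite /a; case: ifP => _; first by rewrite subn1 prednK.
  by case: eqP => // ->; apply: leq_ltn_trans le_l _; rewrite subn1 prednK.
have sum_a : (\sum_i a i = d)%N.
  rewrite def_d (bigD1 k) //= {1}/a ltnn eqxx addnC; congr (_ + _)%N.
  rewrite big_mkcond [RHS]big_mkcond; apply: eq_bigr => i _; rewrite /a.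
  by case: (eqVneq i k) => [->|_] /=; rewrite ?ltnn.
have prod_a : (\prod_i (ds i - a i) = (ds k - l) * \prod_(i < n | (k < i)%N) ds i)%N.
  rewrite (bigD1 k) //= {1}/a ltnn eqxx; congr (_ * _)%N.
  rewrite big_mkcond [RHS]big_mkcond; apply: eq_bigr => i _; rewrite /a -val_eqE.
  by case: ltngtP => //= _; rewrite ?subn0 ?subKn.
rewrite -prod_a; apply: is_min_distI => // [|b lt_b le_b]; first by rewrite sum_a.
by rewrite prod_a -(greedy_weightE hds2 D); apply: greedy_weight_le.
Qed.
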